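(* Let $n\ge2$. Every real correlation matrix $M\in\mathbb{R}^{n\times n}$ has an inverse eigenvector $\alpha\in\mathcal{I}(M)$ of Euclidean norm at most $\sqrt{n}$.
   Context: A real correlation matrix is a real symmetric positive semidefinite matrix all of whose diagonal entries equal $1$. For an $n\times n$ matrix $M$, the set of inverse eigenvectors is $\mathcal{I}(M)=\{\alpha\in\mathbb{C}^n:\ \alpha_k(M\alpha)_k=1\text{ for every }k\in\{1,\dots,n\}\}$; for a real symmetric positive semidefinite $M$ it is contained in $\mathbb{R}^n$. *)

(* Defs.v *)
From HB Require Import structures.
From mathcomp Require Import all_boot all_order all_algebra.
From mathcomp Require Import classical_sets reals.
From mathcomp Require Import complex.

Set Implicit Arguments.
Unset Strict Implicit.
Unset Printing Implicit Defensive.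

Import Order.TTheory GRing.Theory Num.Theory.

Local Open Scope classical_set_scope.
Local Open Scope ring_scope.

Definition psdmx (R : realType) (n : nat) (M : 'M[R]_n) : Prop :=
  M \is symmetricmx /\ forall x : 'cV[R]_n, 0 <= (x^T *m M *m x) 0 0.

Definition correlation_mx (R : realType) (n : nat) (M : 'M[R]_n) : Prop :=
  psdmx M /\ forall k : 'I_n, M k k = 1.

Definition inverse_eigenvectors (R : realType) (n : nat) (M : 'M[R[i]]_n) :
    set 'cV[R[i]]_n :=
  [set a : 'cV[R[i]]_n | forall k : 'I_n, a k 0 * (M *m a) k 0 = 1].

(* The norm [`|z|] of [z : R[i]] has type [R[i]]; [Normc.normc z] is the same
   modulus with type [R]. *)
Definition l2norm (R : realType) (n : nat) (a : 'cV[R[i]]_n) : R :=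
  Num.sqrt (\sum_(k < n) Normc.normc (a k 0) ^+ 2).

(* Main.v *)
Require Import Defs.
From mathcomp Require Import all_boot all_order all_algebra.
From mathcomp Require Import fingroup perm.
From mathcomp Require Import classical_sets reals.
From mathcomp Require Import boolp.
From mathcomp Require Import topology normedtype derive.
From mathcomp Require Import complex.
From mathcomp Require Import ring lra.

(** For a real symmetric matrix [M], call root a real vector [x] with
    [x k * (x *m M) k = 1] for every [k]. The proof averages the squared norm over
    all roots of a positive definite [M] with unit diagonal.

    Such an [M] has a root in each of the [2 ^ n] open orthants: in the positive
    orthant it is a maximizer of the product of the coordinates over an ellipsoid
    ([exists_positive_root]), and the other orthants follow by changing signs
    ([exists_signed_root]). Let [x_E] be the root whose set of negative
    coordinates is [E].

    Consider the kernel [K(x, y) = det (1 + diag (x k * y k) *m M)]. Expanding the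
    determinant ([det_scaled_shift]), [K(x, y)] is the sum over all sets [T] of
    indices of the principal minor [m_T] of [M] times the monomials [x^T] and
    [y^T], where [x^T] is the product of the [x k] for [k] in [T]. If [x] and [y]
    are distinct roots then [x - y] is in the kernel of a matrix with this
    determinant, hence [K(x, y) = 0] ([det_scaled_shift_distinct_roots]); and
    [K(x, x) > 0] by definiteness ([det_scaled_shift_gt0]). So the square matrix
    [V] with entries [x_E^T], the diagonal matrix [D] of the minors and the
    diagonal matrix [W] of the weights [1 / K(x_E, x_E)] satisfy
    [V D V^T W = 1]. A one-sided inverse is two-sided, so [D V^T W V = 1]
    ([dual_orthogonality]): the sum over [E] of [x_E^T x_E^U / K(x_E, x_E)],
    multiplied by [m_T], is [1] if [T = U] and [0] otherwise. For [T = U] empty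
    this says that the weights have sum [1], and for [T = U = {k}] that the
    weighted mean of the squares of the [k]-th coordinates is [1 / M k k = 1].
    Hence the mean squared norm of a root is [n], and some root has norm at most
    the square root of [n] ([exists_small_root]).

    A semidefinite [M] is the limit of the definite matrices
    [(1 - t) M + t 1], whose small roots stay in a fixed ball; by compactness [M]
    has a root in this ball ([psd_exists_small_root]). *)

Import Order.TTheory GRing.Theory Num.Theory.
Import numFieldNormedType.Exports.

Local Open Scope ring_scope.

(** * Quadratic forms *)

Definition qform {R : pzRingType} {n : nat} (M : 'M[R]_n) (x : 'rV[R]_n) : R :=
  (x *m M *m x^T) 0 0.

Lemma qformE (R : comPzRingType) (n : nat) (M : 'M[R]_n) (x : 'rV[R]_n) :
  qform M x = \sum_k x 0 k * (x *m M) 0 k.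
Proof.
by rewrite /qform mxE; apply: eq_bigr => k _; rewrite [x^T _ _]mxE mulrC.
Qed.

Lemma qformZ (R : comPzRingType) (n : nat) (M : 'M[R]_n) (a : R)
    (x : 'rV[R]_n) : qform M (a *: x) = a ^+ 2 * qform M x.
Proof.
by rewrite /qform linearZ /= -!scalemxAl -scalemxAr !mxE expr2 !mulrA.
Qed.

Lemma qform_perturb (R : comPzRingType) (n : nat) (M : 'M[R]_n)
    (x : 'rV[R]_n) (k : 'I_n) (t : R) : M^T = M ->
  qform M (x + t *: delta_mx 0 k) =
  qform M x + t * (x *m M) 0 k *+ 2 + t ^+ 2 * M k k.
Proof.
move=> Ms; pose e := delta_mx 0 k : 'rV[R]_n.
have xMe (y : 'rV[R]_n) : (y *m M *m e^T) 0 0 = (y *m M) 0 k.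
  by rewrite trmx_delta -colE mxE.
have eMx : (e *m M *m x^T) 0 0 = (x *m M) 0 k.
  rewrite -xMe; have -> : e *m M *m x^T = (x *m M *m e^T)^T.
    by rewrite !trmx_mul trmxK Ms mulmxA.
  by rewrite [LHS]mxE.
rewrite /qform linearD /= linearZ /= !mulmxDl !mulmxDr -!scalemxAl -!scalemxAr.
have mxD (A B : 'M[R]_1) : (A + B) 0 0 = A 0 0 + B 0 0 by rewrite mxE.
have mxZ a (A : 'M[R]_1) : (a *: A) 0 0 = a * A 0 0 by rewrite mxE.
rewrite -/e !(mxD, mxZ) !xMe eMx.
have -> : (e *m M) 0 k = M k k by rewrite -rowE mxE.
rewrite mulr2n; ring.
Qed.

(** * Determinants of scaled shifts *)

Definition scaled_shift {R : pzRingType} {n : nat} (N : 'M[R]_n)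
    (v : 'I_n -> R) : 'M[R]_n :=
  \matrix_(i, j) ((i == j)%:R + v i * N i j).

(** Replacing the rows outside [T] by those of the identity matrix gives the
    minor of [N] on [T] without having to reindex a submatrix. *)
Definition principal_minor {R : pzRingType} {n : nat} (N : 'M[R]_n)
    (T : {set 'I_n}) : R :=
  \det (\matrix_(i, j) if i \in T then N i j else (i == j)%:R).

Lemma principal_minor0 (R : comPzRingType) (n : nat) (N : 'M[R]_n) :
  principal_minor N finset.set0 = 1.
Proof.
rewrite /principal_minor -[RHS](det1 R n); congr (\det _).
by apply/matrixP => i j; rewrite !mxE finset.in_set0.
Qed.

Lemma principal_minor1 (R : comPzRingType) (n : nat) (N : 'M[R]_n) (k : 'I_n) :
  principal_minor N [set k] = N k k.
Proof.
rewrite /principal_minor /determinant (bigD1 (1%g : {perm 'I_n})) //=.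
rewrite odd_perm1 mul1r.
rewrite [X in X + _](bigD1 k) //= !mxE set11 perm1 big1 ?mulr1; last first.
  by move=> i ik; rewrite mxE inE (negbTE ik) perm1 eqxx.
rewrite big1 ?addr0 // => s s1.
have [i ik sii] : exists2 i, i != k & s i != i.
  have [i sii] : exists i, s i != i.
    apply/existsP; apply: contraR s1; rewrite negb_exists => /forallP s1.
    by apply/eqP/permP => i; rewrite perm1; apply/eqP; rewrite -[_ == _]negbK.
  have [ik|ik] := eqVneq i k; last by exists i.
  by exists (s i); [rewrite -ik | rewrite (inj_eq perm_inj)].
by rewrite (bigD1 i) //= mxE inE (negbTE ik) eq_sym (negbTE sii) mul0r mulr0.
Qed.

(** This expansion is multi-affine in [v]. At [v k = x k * y k] it separates
    into products of a monomial in [x] and the same monomial in [y], so that it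
    is an entry of a product of matrices. *)
Lemma det_scaled_shift (R : comPzRingType) (n : nat) (N : 'M[R]_n)
    (v : 'I_n -> R) :
  \det (scaled_shift N v) =
  \sum_(T : {set 'I_n}) principal_minor N T * \prod_(k in T) v k.
Proof.
rewrite /determinant.
under eq_bigr => s _.
  under eq_bigr => i _ do rewrite mxE addrC.
  rewrite bigA_distr big_distrr /=; over.
rewrite exchange_big /=; apply: eq_bigr => T _.
rewrite /principal_minor /determinant big_distrl /=; apply: eq_bigr => s _.
rewrite -mulrA; congr (_ * _).
rewrite (big_mkcond (mem T)) -big_split /=; apply: eq_bigr => i _.
by rewrite mxE; case: ifP => _; rewrite ?mulr1 // mulrC.
Qed.

(** Stated for functions on a finite type because rows and columns are indexed by
    sets in [dual_orthogonality]; the enumeration of these sets stays inside this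
    proof. *)
Lemma fun_mulmx1C (R : comNzRingType) (I : finType) (A B : I -> I -> R) :
  (forall i j, \sum_k A i k * B k j = (i == j)%:R) ->
  forall i j, \sum_k B i k * A k j = (i == j)%:R.
Proof.
move=> AB i j.
pose mx (F : I -> I -> R) : 'M_(#|I|) :=
  \matrix_(p, q) F (enum_val p) (enum_val q).
have mxM F G p q :
    (mx F *m mx G) p q = \sum_k F (enum_val p) k * G k (enum_val q).
  rewrite mxE (reindex_onto enum_rank enum_val) /=; last first.
    by move=> k _; rewrite enum_valK.
  apply: eq_big => [k|k _]; first by rewrite enum_rankK eqxx.
  by rewrite !mxE enum_rankK.
have /mulmx1C/matrixP/(_ (enum_rank i) (enum_rank j)) : mx A *m mx B = 1%:M.
  by apply/matrixP => p q; rewrite mxM AB mxE (inj_eq enum_val_inj).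
by rewrite mxM mxE !enum_rankK (inj_eq enum_rank_inj).
Qed.

(** The difference [x - y] is in the kernel: coordinate [k] of its image is
    [(x k - y k) + x k * y k * (1 / x k - 1 / y k) = 0], because
    [(x *m M) k = 1 / x k] and [(y *m M) k = 1 / y k]. *)
Lemma det_scaled_shift_distinct_roots (F : fieldType) (n : nat) (M : 'M[F]_n)
    (x y : 'rV[F]_n) : M^T = M -> x != y ->
  (forall k, x 0 k * (x *m M) 0 k = 1) ->
  (forall k, y 0 k * (y *m M) 0 k = 1) ->
  \det (scaled_shift M (fun k => x 0 k * y 0 k)) = 0.
Proof.
move=> Ms xy hx hy; apply/eqP; rewrite -det_tr; apply/det0P.
exists (x - y); first by rewrite subr_eq0.
apply/rowP => j; rewrite [RHS]mxE mxE.
transitivity ((x - y) 0 j + x 0 j * y 0 j * ((x - y) *m M) 0 j).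
  rewrite [in X in _ = _ + X]mxE big_distrr /=.
  have -> : (x - y) 0 j = \sum_i (x - y) 0 i * (i == j)%:R.
    rewrite -{1}(mulmx1 (x - y)) mxE.
    by apply: eq_bigr => i _; rewrite [1%:M _ _]mxE.
  rewrite -big_split /=.
  apply: eq_bigr => i _.
  by rewrite !mxE -[in LHS]Ms mxE mulrDr (eq_sym j); congr (_ + _); ring.
rewrite mulmxBl !mxE; have := hx j; have := hy j; rewrite !mxE => hy' hx'.
have -> (a b c d : F) : a * b * (c - d) = (a * c) * b - (b * d) * a by ring.
by rewrite hx' hy'; ring.
Qed.

(** The determinant of [1%:M + s *: A] is a polynomial in [s] that equals [1] at
    [0] and has no root on the half-line, hence it keeps its sign. *)
Lemma det_add1_gt0 (R : rcfType) (n : nat) (A : 'M[R]_n) :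
  (forall s, 0 <= s -> \det (1%:M + s *: A) != 0) -> 0 < \det (1%:M + A).
Proof.
move=> hA.
pose P : 'M[{poly R}]_n := 1%:M + 'X *: map_mx polyC A.
have PE s : (\det P).[s] = \det (1%:M + s *: A).
  rewrite -[LHS]/(horner_eval s _) -det_map_mx; congr (\det _).
  apply/matrixP => i j; rewrite !mxE rmorphD rmorph_nat rmorphM /=.
  by rewrite /horner_eval hornerX hornerC.
rewrite -[A in _ < \det (_ + A)]scale1r -PE ltNge; apply/negP => p1.
have [//||s /andP[s0 _] /rootP] := @poly_ivt R (- \det P) 0 1.
  by rewrite !hornerN !PE scale0r addr0 det1 oppr_le0 ler01 oppr_ge0 -PE.
by rewrite hornerN PE => /eqP; rewrite oppr_eq0 (negbTE (hA s s0)).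
Qed.

(** If [z *m (1 + s *: (M *m D)) = 0] with [D] the diagonal matrix of the squares
    of [x], then pairing with [z *m M] gives
    [qform M z = - s * \sum_k ((z *m M) k * x k) ^+ 2], which is at most [0]. *)
Lemma det_scaled_shift_gt0 (R : rcfType) (n : nat) (M : 'M[R]_n)
    (x : 'rV[R]_n) : M^T = M -> (forall z, z != 0 -> 0 < qform M z) ->
  0 < \det (scaled_shift M (fun k => x 0 k * x 0 k)).
Proof.
move=> Ms Mpd; rewrite -det_tr.
pose A : 'M[R]_n := \matrix_(i, j) (M i j * x 0 j ^+ 2).
have -> : (scaled_shift M (fun k => x 0 k * x 0 k))^T = 1%:M + A.
  apply/matrixP => i j; rewrite !mxE eq_sym -[in LHS]Ms mxE expr2.
  by congr (_ + _); rewrite mulrC.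
apply: det_add1_gt0 => s s0; apply/negP => /det0P[z z0] /rowP hz.
suff: qform M z <= 0 by rewrite leNgt Mpd.
rewrite qformE -oppr_ge0 -sumrN; apply: sumr_ge0 => k _.
have : z 0 k = - (s * ((z *m M) 0 k * x 0 k ^+ 2)).
  apply/eqP; rewrite -subr_eq0 opprK; apply/eqP.
  move: (hz k); rewrite mulmxDr mulmx1 -scalemxAr !mxE => h; rewrite -[RHS]h.
  congr (_ + s * _); rewrite big_distrl /=; apply: eq_bigr => i _.
  by rewrite [A _ _]mxE -mulrA.
move=> ->; rewrite mulNr opprK.
have -> (a b c : R) : a * (b * c ^+ 2) * b = a * (b * c) ^+ 2 by ring.
by rewrite mulr_ge0 // sqr_ge0.
Qed.

(** * One root in every orthant *)

Lemma mulmx_coord_continuous (R : realType) (n : nat) (M : 'M[R]_n) (k : 'I_n) :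
  continuous (fun x : 'rV[R]_n => (x *m M) 0 k).
Proof.
have -> : (fun x : 'rV[R]_n => (x *m M) 0 k) =
    (fun x => \sum_i x 0 i * M i k) by apply/funext => x; rewrite mxE.
apply: continuous_big => [|i _ x]; first exact: add_continuous.
by apply: continuousM; [exact: coord_continuous | exact: cst_continuous].
Qed.

Lemma root_coord_continuous (R : realType) (n : nat) (M : 'M[R]_n) (k : 'I_n) :
  continuous (fun x : 'rV[R]_n => x 0 k * (x *m M) 0 k).
Proof.
move=> x; apply: continuousM; first exact: coord_continuous.
exact: mulmx_coord_continuous.
Qed.

Lemma qform_continuous (R : realType) (n : nat) (M : 'M[R]_n) :
  continuous (qform M).
Proof.
have -> : qform M = (fun x => \sum_k x 0 k * (x *m M) 0 k).
  by apply/funext => x; rewrite qformE.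
apply: continuous_big => [|i _]; first exact: add_continuous.
exact: root_coord_continuous.
Qed.

Lemma box_compact (R : realType) (n : nat) (a b : R) :
  compact [set x : 'rV[R]_n | forall i, a <= x 0 i <= b]%classic.
Proof.
have := @rV_compact R n (fun=> `[a, b]%classic) (fun=> @segment_compact R a b).
by congr compact; apply/eq_set => x; apply/eq_forall => i; rewrite /= in_itv.
Qed.

(** Bernoulli's inequality for [(1 - r) ^+ n], in the multiplied-out form that
    bounds [(1 + r) ^+ n] from above and holds for every nonnegative [r]. *)
Lemma inv_bernoulli (R : numDomainType) (r : R) (n : nat) : 0 <= r ->
  (1 + r) ^+ n * (1 - n%:R * r) <= 1.
Proof.
move=> r0; elim: n => [|n IH]; first by rewrite expr0 mul1r mul0r subr0.
apply: le_trans IH; rewrite exprSr -mulrA ler_wpM2l ?exprn_ge0 ?addr_ge0 //.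
rewrite -subr_ge0 -natr1.
have -> : 1 - n%:R * r - (1 + r) * (1 - (n%:R + 1) * r) =
  n%:R * r ^+ 2 + r ^+ 2 by ring.
by rewrite addr_ge0 ?mulr_ge0 ?ler0n ?exprn_ge0.
Qed.

(** A maximizer [x] of the product of the coordinates over the nonnegative
    vectors with [qform M x <= n.+1] is a root. It suffices that every
    [x k * (x *m M) k] is at least [1], because these numbers add up to
    [qform M x], which is at most their number. If one were smaller than [1],
    enlarging the coordinate [x k] slightly and scaling the vector back into the
    domain would increase the product. *)
Lemma exists_positive_root (R : realType) (n : nat) (M : 'M[R]_n.+1) (c : R) :
  M^T = M -> 0 < c ->
  (forall x : 'rV[R]_n.+1, c * \sum_k x 0 k ^+ 2 <= qform M x) ->
  exists x : 'rV[R]_n.+1,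
    (forall k, 0 < x 0 k) /\ (forall k, x 0 k * (x *m M) 0 k = 1).
Proof.
move=> Ms c0 Mc; set N : R := n.+1%:R.
have N1 : 1 <= N by rewrite ler1n.
have Q0 x : 0 <= qform M x.
  by apply: le_trans (Mc x); rewrite mulr_ge0 ?(ltW c0) ?sumr_ge0 // => k _;
    rewrite sqr_ge0.
(* Coordinates in the domain have squares at most [N / c], hence are at most
   [B] because [1 <= B]. *)
pose B : R := N / c + 1.
have Nc0 : 0 <= N / c by rewrite divr_ge0 ?(ltW c0) ?ler0n.
pose S : set 'rV[R]_n.+1 := ([set x : 'rV[R]_n.+1 | forall i, 0 <= x 0 i <= B] `&`
  [set x | qform M x <= N])%classic.
have Scpt : compact S.
  apply: compact_closedI; first exact: box_compact.
  have /continuous_closedP cq := @qform_continuous R n.+1 M.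
  exact: (cq _ (@closed_le _ N)).
have inS (y : 'rV[R]_n.+1) : (forall i, 0 <= y 0 i) -> qform M y <= N -> S y.
  move=> y0 yN; split => //= i; rewrite y0 /=.
  have : c * y 0 i ^+ 2 <= N.
    apply: le_trans yN; apply: le_trans (Mc y); rewrite ler_wpM2l ?(ltW c0) //.
    by rewrite (bigD1 i) //= lerDl sumr_ge0 // => k _; rewrite sqr_ge0.
  rewrite -ler_pdivlMl // mulrC => yi.
  by rewrite /B; have := y0 i; nra.
(* A point of the domain with positive coordinates, so that the maximum is
   positive. *)
pose o : 'rV[R]_n.+1 := (1 + qform M (const_mx 1))^-1 *: const_mx 1.
have oE i : o 0 i = (1 + qform M (const_mx 1))^-1 by rewrite !mxE mulr1.
have o0 i : 0 < o 0 i.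
  by rewrite oE invr_gt0; have := Q0 (const_mx 1); lra.
have So : S o.
  apply: inS => [i|]; first exact: ltW.
  rewrite qformZ; have := Q0 (const_mx 1); set q := qform _ _ => q0.
  apply: le_trans N1; rewrite exprVn ler_pdivrMl ?mulr1 ?exprn_gt0 //; last lra.
  nra.
have [] := @compact_EVT_max _ R (fun x : 'rV[R]_n.+1 => \prod_k x 0 k) S.
- by exists o.
- exact: Scpt.
- apply: continuous_subspaceT.
  apply: continuous_big => [|i _]; first exact: mul_continuous.
  exact: coord_continuous.
move=> x /set_mem[/= x01 xN] xmax.
have x0 i : 0 <= x 0 i by case/andP: (x01 i).
have {xmax}xmax (y : 'rV[R]_n.+1) : (forall i, 0 <= y 0 i) -> qform M y <= N ->
    \prod_k y 0 k <= \prod_k x 0 k.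
  by move=> y0 yN; apply: xmax; apply/mem_set; exact: inS.
have P0 : 0 < \prod_k x 0 k.
  by apply: lt_le_trans (xmax o _ _); [exact: prodr_gt0|move=> i; exact: ltW
    |case: So].
have {}x0 i : 0 < x 0 i.
  rewrite lt_def x0 andbT; apply: contraTneq P0 => xi.
  by rewrite (bigD1 i) //= xi mul0r ltxx.
exists x; split=> //.
have c1 k : 1 <= x 0 k * (x *m M) 0 k.
  rewrite leNgt; apply/negP; set ck := _ * _ => ck1.
  (* [c'] replaces [ck] so that [r] below is nonnegative even if [ck] is
     negative. *)
  pose c' : R := Num.max 0 ck.
  have c'0 : 0 <= c' by rewrite le_max lexx.
  have ckc' : ck <= c' by rewrite le_max lexx orbT.
  have c'1 : c' < 1 by rewrite gt_max ltr01.
  have Mkk : 0 <= M k k.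
    by have := Q0 (delta_mx 0 k);
      rewrite /qform trmx_delta -colE -rowE !mxE.
  pose d : R := x 0 k ^+ 2 * M k k.
  have d0 : 0 <= d by rewrite mulr_ge0 ?sqr_ge0.
  (* Relative increase of the coordinate [k], small enough for
     [(1 + s) * (1 - N * r) > 1]. *)
  pose s : R := (1 - c') / (d + 2).
  have d2 : 0 < d + 2 by lra.
  have s0 : 0 < s by rewrite divr_gt0 // subr_gt0.
  have sd : s * (d + 2) = 1 - c' by rewrite divfK // lt0r_neq0.
  (* Since [(1 + r) ^+ 2 >= 1 + 2 * r], dividing by [1 + r] brings the quadratic
     form of the perturbed vector back below [N]. *)
  pose r : R := (s * c' *+ 2 + s ^+ 2 * d) / (2 * N).
  have Nr : N * r *+ 2 = s * c' *+ 2 + s ^+ 2 * d.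
    have N20 : 0 < 2 * N by lra.
    have -> : N * r *+ 2 = r * (2 * N) by ring.
    by rewrite divfK // lt0r_neq0.
  have r0 : 0 <= r by rewrite divr_ge0 //; nra.
  have r1 : 0 < 1 + r by lra.
  pose y : 'rV[R]_n.+1 := (1 + r)^-1 *: (x + (s * x 0 k) *: delta_mx 0 k).
  have : \prod_i y 0 i <= \prod_i x 0 i.
    apply: xmax => [i|].
      rewrite !mxE mulr_ge0 ?invr_ge0 ?(ltW r1) // addr_ge0 ?(ltW (x0 i)) //.
      by apply: mulr_ge0; [exact/ltW/mulr_gt0 | exact: ler0n].
    rewrite qformZ qform_perturb // exprVn ler_pdivrMl ?exprn_gt0 //.
    have -> : (s * x 0 k) * (x *m M) 0 k = s * ck by rewrite -mulrA.
    have -> : (s * x 0 k) ^+ 2 * M k k = s ^+ 2 * d by rewrite exprMn -mulrA.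
    have : s * ck <= s * c' by rewrite ler_wpM2l ?(ltW s0).
    nra.
  have -> : \prod_i y 0 i =
      (1 + r) ^- n.+1 * (1 + s) * \prod_i x 0 i.
    rewrite (eq_bigr (fun i => (1 + r)^-1 * ((1 + s * (i == k)%:R) * x 0 i))).
      rewrite !big_split /= prodr_const card_ord exprVn -mulrA.
      congr (_ * (_ * _)).
      by rewrite (bigD1 k) //= eqxx mulr1 big1 ?mulr1 // => i /negbTE ->;
        rewrite mulr0 addr0.
    move=> i _; rewrite !mxE eqxx /=; congr (_ * _).
    by case: eqP => [->|_]; rewrite /=; ring.
  rewrite ger_pMl // ler_pdivrMl ?exprn_gt0 // mulr1 => h1.
  have := inv_bernoulli _ r n.+1 r0; rewrite -/N => h2.
  have Nr1 : 0 < 1 - N * r by nra.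
  have : (1 + s) * (1 - N * r) <= 1.
    by apply: le_trans h2; rewrite ler_wpM2r // ltW.
  nra.
move=> k; apply/eqP; rewrite eq_le c1 andbT -subr_le0.
have : \sum_i (x 0 i * (x *m M) 0 i - 1) <= 0.
  by rewrite sumrB -qformE sumr_const card_ord -/N subr_le0.
apply: le_trans; rewrite (bigD1 k) //= lerDl sumr_ge0 // => i _.
by rewrite subr_ge0.
Qed.

(** Conjugating [M] by a diagonal matrix of signs carries the positive orthant to
    the orthant in which [E] is the set of negative coordinates. *)
Lemma exists_signed_root (R : realType) (n : nat) (M : 'M[R]_n.+1) (c : R)
    (E : {set 'I_n.+1}) :
  M^T = M -> 0 < c ->
  (forall x : 'rV[R]_n.+1, c * \sum_k x 0 k ^+ 2 <= qform M x) ->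
  exists x : 'rV[R]_n.+1,
    (forall k, 0 < (-1) ^+ (k \in E) * x 0 k) /\
    (forall k, x 0 k * (x *m M) 0 k = 1).
Proof.
move=> Ms c0 Mc; pose e : 'rV[R]_n.+1 := \row_k (-1) ^+ (k \in E).
have xeE (x : 'rV[R]_n.+1) k : (x *m diag_mx e) 0 k = x 0 k * (-1) ^+ (k \in E).
  by rewrite mul_mx_diag !mxE.
pose N := diag_mx e *m M *m diag_mx e.
have [||x [x0 xr]] := @exists_positive_root R n N c _ c0.
- by rewrite /N !trmx_mul Ms tr_diag_mx mulmxA.
- move=> x; have := Mc (x *m diag_mx e).
  rewrite /N /qform trmx_mul tr_diag_mx !mulmxA; congr (c * _ <= _).
  by apply: eq_bigr => k _; rewrite xeE exprMn sqrr_sign mulr1.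
exists (x *m diag_mx e); split=> k; rewrite xeE.
  by rewrite mulrCA -signr_addb addbb mulr1.
by rewrite -[RHS](xr k) -mulrA; congr (_ * _); rewrite /N !mulmxA xeE mulrC.
Qed.

(** * The weighted average over all roots *)

(** The hypothesis [hK] says that the vectors of monomials
    [\prod_(k in T) x E 0 k], indexed by [T], are orthogonal for the weights
    [principal_minor M T] as [E] varies. There are as many sets [E] as sets [T],
    so these vectors form an invertible square matrix, and its columns are then
    orthogonal for the weights [(K E)^-1]. *)
Lemma dual_orthogonality (F : fieldType) (n : nat) (M : 'M[F]_n)
    (x : {set 'I_n} -> 'rV[F]_n) (K : {set 'I_n} -> F) :
  (forall E, K E != 0) ->
  (forall E E', \det (scaled_shift M (fun k => x E 0 k * x E' 0 k)) =
                K E *+ (E == E')) ->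
  forall T U : {set 'I_n}, principal_minor M T *
    \sum_E (\prod_(k in T) x E 0 k) * (\prod_(k in U) x E 0 k) / K E =
    (T == U)%:R.
Proof.
move=> K0 hK T U.
pose A (E T : {set 'I_n}) := \prod_(k in T) x E 0 k.
pose B (T E : {set 'I_n}) := principal_minor M T * A E T / K E.
have AB E E' : \sum_V A E V * B V E' = (E == E')%:R.
  transitivity ((K E *+ (E == E')) / K E'); last first.
    by case: eqP => [->|_]; [exact/divff/K0 | exact: mul0r].
  rewrite -hK det_scaled_shift big_distrl /=; apply: eq_bigr => V _.
  by rewrite big_split /= /A /B /A; ring.
rewrite -(fun_mulmx1C _ _ _ _ AB) mulr_sumr.
by apply: eq_bigr => E _; rewrite /B /A; ring.
Qed.

(** For the probability weights [(K E)^-1] each [x E 0 k ^+ 2] has mean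
    [(M k k)^-1 = 1], so the squared norm has mean [n.+1]; some root is not above
    the mean. *)
Lemma exists_small_root (R : realType) (n : nat) (M : 'M[R]_n.+1) (c : R) :
  M^T = M -> (forall k, M k k = 1) -> 0 < c ->
  (forall x : 'rV[R]_n.+1, c * \sum_k x 0 k ^+ 2 <= qform M x) ->
  exists x : 'rV[R]_n.+1,
    (forall k, x 0 k * (x *m M) 0 k = 1) /\ \sum_k x 0 k ^+ 2 <= n.+1%:R.
Proof.
move=> Ms M1 c0 Mc.
have [x /all_and2[xs xr]] :=
  choice (fun E => exists_signed_root R n M c E Ms c0 Mc).
have Mpd (z : 'rV[R]_n.+1) : z != 0 -> 0 < qform M z.
  move=> z0; apply: lt_le_trans (Mc z); rewrite mulr_gt0 //.
  have [k zk] := rV0Pn z z0.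
  rewrite (bigD1 k) //= ltr_pwDl ?exprn_even_gt0 ?zk ?orbT //.
  by rewrite sumr_ge0 // => i _; rewrite sqr_ge0.
pose K E := \det (scaled_shift M (fun k => x E 0 k * x E 0 k)).
have K0 E : 0 < K E by exact: det_scaled_shift_gt0.
have hK E E' : \det (scaled_shift M (fun k => x E 0 k * x E' 0 k)) =
    K E *+ (E == E').
  have [<-//|EE'] := eqVneq E E'.
  apply: det_scaled_shift_distinct_roots => //; apply: contra_neq EE' => xx.
  (* Equal roots have equal signs, and the signs of [x E] determine [E]. *)
  apply/setP => k; have := xs E k; have := xs E' k; rewrite xx.
  by case: (k \in E); case: (k \in E') => //=; lra.
have W := dual_orthogonality R n.+1 M x K (fun E => lt0r_neq0 (K0 E)) hK.
have W0 : \sum_E (K E)^-1 = 1.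
  have := W finset.set0 finset.set0; rewrite eqxx principal_minor0 mul1r => e.
  rewrite -[RHS]e.
  by apply: eq_bigr => E _; rewrite !big_set0 !mul1r.
have W1 k : \sum_E x E 0 k ^+ 2 / K E = 1.
  have := W [set k] [set k]; rewrite eqxx principal_minor1 M1 mul1r => e.
  rewrite -[RHS]e.
  by apply: eq_bigr => E _; rewrite !big_set1 expr2.
apply: contrapT => /forallNP none.
have : 0 < \sum_E (\sum_k x E 0 k ^+ 2 - n.+1%:R) / K E.
  have pos E : 0 < (\sum_k x E 0 k ^+ 2 - n.+1%:R) / K E.
    rewrite divr_gt0 // subr_gt0 ltNge; apply/negP => small.
    by apply: (none (x E)).
  rewrite (bigD1 finset.set0) //= ltr_pwDl // sumr_ge0 // => E _; exact: ltW.
under eq_bigr => E _ do rewrite mulrBl mulr_suml.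
rewrite sumrB exchange_big /= -mulr_sumr W0.
under eq_bigr => k _ do rewrite W1.
by rewrite sumr_const card_ord mulr1 subrr ltxx.
Qed.

(** * Passage to semidefinite matrices *)

(** The matrices [M - t *: (M - 1%:M)], for [t] in the interval from [0]
    (excluded) to [1], are definite with unit diagonal. Their small roots fail to
    be roots of [M] only by an error of order [t], uniformly on a ball; hence the
    sum of the squared errors, which attains its minimum on that ball, has
    minimum [0]. *)
Lemma psd_exists_small_root (R : realType) (n : nat) (M : 'M[R]_n.+1) :
  M^T = M -> (forall k, M k k = 1) -> (forall x, 0 <= qform M x) ->
  exists x : 'rV[R]_n.+1,
    (forall k, x 0 k * (x *m M) 0 k = 1) /\ \sum_k x 0 k ^+ 2 <= n.+1%:R.
Proof.
move=> Ms M1 M0; set N : R := n.+1%:R.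
have N1 : 1 <= N by rewrite ler1n.
have q1 (x : 'rV[R]_n.+1) : qform 1%:M x = \sum_k x 0 k ^+ 2.
  by rewrite qformE mulmx1; apply: eq_bigr => k _; rewrite expr2.
have mxB (u v : 'rV[R]_n.+1) k : (u - v) 0 k = u 0 k - v 0 k by rewrite !mxE.
have mxZ a (u : 'rV[R]_n.+1) k : (a *: u) 0 k = a * u 0 k by rewrite mxE.
pose S : set 'rV[R]_n.+1 :=
  ([set x : 'rV[R]_n.+1 | forall i, - N <= x 0 i <= N] `&`
   [set x | qform 1%:M x <= N])%classic.
have Scpt : compact S.
  apply: compact_closedI; first exact: box_compact.
  have /continuous_closedP cq := @qform_continuous R n.+1 1%:M.
  exact: (cq _ (@closed_le _ N)).
have inS (y : 'rV[R]_n.+1) : \sum_k y 0 k ^+ 2 <= N -> S y.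
  move=> yN; split; rewrite /= ?q1 // => i.
  have : y 0 i ^+ 2 <= N.
    by apply: le_trans yN; rewrite (bigD1 i) //= lerDl sumr_ge0 // => k _;
      rewrite sqr_ge0.
  by move=> yi; apply/andP; split; nra.
have Sn0 : (S !=set0)%classic.
  exists 0; apply: inS; rewrite big1 ?(le_trans ler01) // => k _.
  by rewrite mxE expr0n.
pose G (A : 'M[R]_n.+1) (a : R) (x : 'rV[R]_n.+1) :=
  \sum_k (x 0 k * (x *m A) 0 k - a) ^+ 2.
have G0 A a x : 0 <= G A a x by rewrite sumr_ge0 // => k _; rewrite sqr_ge0.
have Gc A a : continuous (G A a).
  apply: continuous_big => [|i _ x]; first exact: add_continuous.
  pose u (y : 'rV[R]_n.+1) : R := y 0 i * (y *m A) 0 i - a.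
  suff uc : continuous u by exact: (continuousM (uc x) (uc x)).
  move=> y; have vc := @root_coord_continuous R n.+1 A i y.
  exact: (continuousB vc (@cst_continuous _ _ a y)).
have [x /set_mem[_ /= xN] xmin] := @compact_EVT_min _ R (G M 1) S Sn0 Scpt
  (continuous_subspaceT (Gc _ _)).
have [z _ zmax] := @compact_EVT_max _ R (G (M - 1%:M) 0) S Sn0 Scpt
  (continuous_subspaceT (Gc _ _)).
set g := G M 1 x in xmin; set h := G (M - 1%:M) 0 z in zmax.
have g0 : 0 <= g by exact: G0.
have h0 : 0 <= h by exact: G0.
have gth t : 0 < t -> t <= 1 -> g <= t ^+ 2 * h.
  move=> t0 t1; pose Mt := M - t *: (M - 1%:M).
  have [|k|y|y [yr yN]] := exists_small_root R n Mt t _ _ t0.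
  - by rewrite /Mt !(linearB, linearZ) /= Ms tr_scalar_mx.
  - by rewrite !mxE M1 eqxx subrr mulr0 subr0.
  - have -> : qform Mt y = (1 - t) * qform M y + t * qform 1%:M y.
      rewrite !qformE !mulr_sumr -big_split /=; apply: eq_bigr => k _.
      rewrite mulmxBr -scalemxAr mulmxBr mulmx1.
      by rewrite !(mxB, mxZ); ring.
    by rewrite q1 lerDr mulr_ge0 // subr_ge0.
  have yS : y \in S by apply/mem_set; exact: inS.
  apply: le_trans (xmin y yS) _.
  have -> : G M 1 y = t ^+ 2 * G (M - 1%:M) 0 y.
    rewrite mulr_sumr; apply: eq_bigr => k _.
    rewrite -[X in (_ - X) ^+ 2](yr k) subr0 -exprMn /Mt mulmxBr -scalemxAr.
    by set u := _ *m (_ - _); rewrite mxB mxZ; ring.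
  by rewrite ler_wpM2l ?sqr_ge0 ?zmax.
exists x; split; last by rewrite -q1.
have {gth} : g = 0.
  apply/eqP; rewrite eq_le g0 andbT leNgt; apply/negP => gpos.
  (* With this [t <= 1], [t ^+ 2 * h <= t * h < g]. *)
  pose t : R := g / (g + h + 1).
  have d0 : 0 < g + h + 1 by lra.
  have t0 : 0 < t by rewrite divr_gt0.
  have td : t * (g + h + 1) = g by rewrite divfK // lt0r_neq0.
  have t1 : t <= 1 by rewrite ler_pdivrMr // mul1r; lra.
  have := gth t t0 t1; nra.
move/eqP; rewrite psumr_eq0 => [/allP/= sq0 k|k _]; last exact: sqr_ge0.
have := sq0 k (mem_index_enum k); rewrite sqrf_eq0 subr_eq0 => /eqP; exact.
Qed.

Theorem corollary1 (R : realType) (n : nat) (hn : (2 <= n)%N) (M : 'M[R]_n)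
    (hM : correlation_mx M) :
  exists a : 'cV[R[i]]_n,
    inverse_eigenvectors (map_mx (real_complex R) M) a /\
    l2norm a <= Num.sqrt n%:R.
Proof.
case: n hn M hM => // n _ M [[/is_hermitianmxP Ms M0] M1].
have {}Ms : M^T = M.
  by rewrite [in RHS]Ms expr0 scale1r map_mx_id.
have [|x [xr xN]] := psd_exists_small_root R n M Ms M1.
  by move=> x; have := M0 x^T; rewrite trmxK.
exists (map_mx (real_complex R) x^T); split.
  move=> k; rewrite -map_mxM !mxE -rmorphM /=.
  have -> : \sum_j M k j * x^T j 0 = (x *m M) 0 k.
    by rewrite mxE; apply: eq_bigr => j _; rewrite mxE mulrC -[in LHS]Ms mxE.
  by rewrite xr.
rewrite /l2norm ler_sqrt ?ler0n //; apply: le_trans xN.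
apply: ler_sum => k _; rewrite !mxE /Normc.normc /= expr0n addr0.
by rewrite sqrtr_sqr real_normK ?num_real.
Qed.
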